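(* Let $\tau=\tau^1\mbox{-}\tau^2\mbox{-}\cdots\mbox{-}\tau^s$ be a multi-pattern, where each $\tau^i$ is a non-empty generalized pattern with no hyphens. Then for $k\ge1$, $$A_\tau(x;k)=\sum_{j=1}^s A_{\tau^j}(x;k)\prod_{i=1}^{j-1}\bigl((kx-1)A_{\tau^i}(x;k)+1\bigr).$$
   Context: $[k]^n$ = words of length $n$ over $\{1,\dots,k\}$. A generalized pattern with no hyphens is a word over $[m]$ using every letter of $[m]$; a word contains it if some factor of consecutive letters is order-isomorphic to it (relations $<,=,>$ preserved between all pairs of positions). A multi-pattern $\tau^1\mbox{-}\cdots\mbox{-}\tau^s$ is the concatenation of the blocks with hyphens between them, where letters of different blocks are incomparable; a word $\sigma$ contains it if $\sigma$ has occurrences of $\tau^1,\dots,\tau^s$ in this left-to-right order, pairwise non-overlapping; otherwise $\sigma$ avoids it. For any such pattern $\pi$, $A_\pi(x;k)=\sum_{n\ge0}a_\pi(n;k)x^n$ with $a_\pi(n;k)$ the number of words in $[k]^n$ avoiding $\pi$ ($a_\pi(0;k)=1$). *)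

(* Defs.v *)
From HB Require Import structures.
From mathcomp Require Import all_boot all_order all_algebra.
From mathcomp Require Import boolp.
Set Implicit Arguments.
Unset Strict Implicit.
Unset Printing Implicit Defensive.
Import GRing.Theory.
Local Open Scope ring_scope.

(* Formal power series in one variable over R.  A record rather than an alias
   of [nat -> R], since function types may carry pointwise operations. *)
Record fps (R : comNzRingType) := Fps { fps_coef : nat -> R }.

Lemma fpsP (R : comNzRingType) (f g : fps R) :
  fps_coef f =1 fps_coef g <-> f = g.
Proof.
split=> [|-> //]; case: f g => [f] [g] /= fg.
by congr Fps; apply: funext.
Qed.

HB.instance Definition _ (R : comNzRingType) := gen_eqMixin (fps R).
HB.instance Definition _ (R : comNzRingType) := gen_choiceMixin (fps R).

Definition fps_zero (R : comNzRingType) : fps R := Fps (fun=> 0).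
Definition fps_opp (R : comNzRingType) (f : fps R) : fps R :=
  Fps (fun n => - fps_coef f n).
Definition fps_add (R : comNzRingType) (f g : fps R) : fps R :=
  Fps (fun n => fps_coef f n + fps_coef g n).
Definition fps_one (R : comNzRingType) : fps R := Fps (fun n => (n == 0%N)%:R).
Definition fps_mul (R : comNzRingType) (f g : fps R) : fps R :=
  Fps (fun n => \sum_(i < n.+1) fps_coef f i * fps_coef g (n - i)).

Lemma fps_addA (R : comNzRingType) : associative (@fps_add R).
Proof. by move=> f g h; apply/fpsP => n /=; rewrite addrA. Qed.
Lemma fps_addC (R : comNzRingType) : commutative (@fps_add R).
Proof. by move=> f g; apply/fpsP => n /=; rewrite addrC. Qed.
Lemma fps_add0 (R : comNzRingType) : left_id (fps_zero R) (@fps_add R).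
Proof. by move=> f; apply/fpsP => n /=; rewrite add0r. Qed.
Lemma fps_addN (R : comNzRingType) :
  left_inverse (fps_zero R) (@fps_opp R) (@fps_add R).
Proof. by move=> f; apply/fpsP => n /=; rewrite addNr. Qed.

HB.instance Definition _ (R : comNzRingType) :=
  GRing.isZmodule.Build (fps R)
    (@fps_addA R) (@fps_addC R) (@fps_add0 R) (@fps_addN R).

Definition fps_trunc (R : comNzRingType) (N : nat) (f : fps R) : {poly R} :=
  \poly_(i < N) fps_coef f i.

Lemma fps_coef_mul_trunc (R : comNzRingType) (f g : fps R) (n N : nat) :
  (n < N)%N ->
  fps_coef (fps_mul f g) n = (fps_trunc N f * fps_trunc N g)`_n.
Proof.
move=> nN; rewrite coefM /=; apply: eq_bigr => i _; rewrite !coef_poly.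
have iN : (i < N)%N by apply: leq_ltn_trans nN; rewrite -ltnS.
by rewrite iN (leq_ltn_trans (leq_subr i n) nN).
Qed.

Lemma fps_mulC (R : comNzRingType) : commutative (@fps_mul R).
Proof.
move=> f g; apply/fpsP => n.
by rewrite !(fps_coef_mul_trunc _ _ (ltnSn n)) mulrC.
Qed.

Lemma fps_mulA (R : comNzRingType) : associative (@fps_mul R).
Proof.
have key (f g h : fps R) n : fps_coef (fps_mul (fps_mul f g) h) n
    = (fps_trunc n.+1 f * fps_trunc n.+1 g * fps_trunc n.+1 h)`_n.
  rewrite [RHS]coefM /=; apply: eq_bigr => i _; congr (_ * _).
    exact: (fps_coef_mul_trunc _ _ (ltn_ord i)).
  by rewrite coef_poly ltnS leq_subr.
move=> f g h; apply/fpsP => n.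
by rewrite fps_mulC !key; congr (polyseq _)`_n; rewrite mulrC mulrA.
Qed.

Lemma fps_mul1 (R : comNzRingType) : left_id (fps_one R) (@fps_mul R).
Proof.
move=> f; apply/fpsP => n /=.
by rewrite big_ord_recl /= mul1r subn0 big1 ?addr0 // => i _; rewrite mul0r.
Qed.

Lemma fps_mulDl (R : comNzRingType) :
  left_distributive (@fps_mul R) (@fps_add R).
Proof.
move=> f g h; apply/fpsP => n /=.
by rewrite -big_split; apply: eq_bigr => i _; rewrite mulrDl.
Qed.

Lemma fps_one_neq0 (R : comNzRingType) : fps_one R != 0.
Proof. by apply/eqP => /fpsP /(_ 0%N) /= /eqP; rewrite oner_eq0. Qed.

HB.instance Definition _ (R : comNzRingType) :=
  GRing.Zmodule_isComNzRing.Build (fps R)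
    (@fps_mulA R) (@fps_mulC R) (@fps_mul1 R) (@fps_mulDl R) (@fps_one_neq0 R).

Definition fpsX (R : comNzRingType) : fps R := Fps (fun n => (n == 1%N)%:R).

(* A hyphen-free generalized pattern: the set of letters of t is exactly
   {1, ..., m} for some m. *)
Definition gen_pattern (t : seq nat) : Prop := exists m : nat, t =i iota 1 m.

Definition order_iso (u v : seq nat) : bool :=
  (size u == size v) &&
  [forall i : 'I_(size u), forall j : 'I_(size u),
     ((nth 0 u i < nth 0 u j) == (nth 0 v i < nth 0 v j)) &&
     ((nth 0 u i == nth 0 u j) == (nth 0 v i == nth 0 v j))]%N.

(* No occurrence overhangs the end of w: then the factor is too short. *)
Definition occurs_at (t w : seq nat) (p : nat) : bool :=
  order_iso (take (size t) (drop p w)) t.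

Definition contains (t w : seq nat) : bool :=
  [exists p : 'I_(size w).+1, occurs_at t w p].

Definition mcontains (s : nat) (tau : 'I_s -> seq nat) (w : seq nat) : bool :=
  [exists p : {ffun 'I_s -> 'I_(size w).+1},
     [forall i, occurs_at (tau i) w (p i)] &&
     [forall i : 'I_s, forall j : 'I_s,
        (i < j)%N ==> (p i + size (tau i) <= p j)%N]].

(* Words of [k]^n are n-tuples over 'I_k; the letter i of 'I_k stands for
   i + 1 in {1, ..., k}. *)
Definition word (k n : nat) (w : n.-tuple 'I_k) : seq nat :=
  [seq (nat_of_ord i).+1 | i <- w].

Definition avoid_count (P : pred (seq nat)) (k n : nat) : nat :=
  #|[set w : n.-tuple 'I_k | ~~ P (word w)]|.

Definition avoid_gf (P : pred (seq nat)) (k : nat) : fps int :=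
  Fps (fun n => (avoid_count P k n)%:R).

Definition A_pat (t : seq nat) (k : nat) : fps int := avoid_gf (contains t) k.

Definition A_mpat (s : nat) (tau : 'I_s -> seq nat) (k : nat) : fps int :=
  avoid_gf (mcontains tau) k.

(* Main.v *)
Require Import Defs.
From mathcomp Require Import all_boot all_algebra.
From mathcomp Require Import zify ring.
Local Open Scope ring_scope.

(** A word contains [tau^1-...-tau^s] iff it is [u ++ v] with [u] containing
    [tau^1] and [v] containing [tau^2-...-tau^s], and [u] may be taken to be the
    shortest prefix containing [tau^1].  Such a [u] quasi-avoids [tau^1]: it
    contains [tau^1], but none of its proper prefixes does.  So a word avoiding
    the multi-pattern either avoids [tau^1] or is, in a unique way, a word
    quasi-avoiding [tau^1] followed by one avoiding [tau^2-...-tau^s]: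
    [A_tau = A_(tau^1) + Q * A_(tau^2-...-tau^s)], with [Q] the generating
    function of quasi-avoidance.  Appending a letter to a word avoiding [tau^1]
    gives either a nonempty word avoiding [tau^1] or a word quasi-avoiding it,
    so [Q = (k x - 1) A_(tau^1) + 1].  The recursion ends at the multi-pattern
    without blocks, which every word contains. *)

Import GRing.Theory.
Set Implicit Arguments.
Unset Strict Implicit.
Unset Printing Implicit Defensive.

Lemma fps_coefMn (R : comNzRingType) (f : fps R) (m n : nat) :
  fps_coef (f *+ m) n = fps_coef f n *+ m.
Proof. by elim: m => // m IHm; rewrite !mulrSr /= IHm. Qed.

Lemma big_tuple_cat (V : Type) (idx : V) (op : Monoid.com_law idx)
    (T : finType) (m n : nat) (F : seq T -> V) :
  \big[op/idx]_(w : (m + n).-tuple T) F w =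
  \big[op/idx]_(u : m.-tuple T) \big[op/idx]_(v : n.-tuple T) F (u ++ v).
Proof.
pose cat_pair (uv : m.-tuple T * n.-tuple T) := cat_tuple uv.1 uv.2.
have cat_pair_inj : injective cat_pair.
  move=> [u v] [u' v'] /(congr1 val) /= /eqP.
  by rewrite eqseq_cat ?size_tuple // => /andP[/eqP/val_inj-> /eqP/val_inj->].
have cat_pair_bij : bijective cat_pair.
  by apply: inj_card_bij cat_pair_inj _; rewrite card_prod !card_tuple expnD.
by rewrite pair_big (reindex cat_pair) //; apply: onW_bij.
Qed.

Lemma sum_prod_lt_recl (R : comPzSemiRingType) (s : nat) (F G : 'I_s.+1 -> R) :
  \sum_(j < s.+1) F j * \prod_(i < s.+1 | (i < j)%N) G i =
  F ord0 + G ord0 * \sum_(j < s) F (lift ord0 j) *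
                      \prod_(i < s | (i < j)%N) G (lift ord0 i).
Proof.
rewrite big_ord_recl big_pred0 // mulr1; congr (_ + _).
rewrite big_distrr /=; apply: eq_bigr => j _.
by rewrite mulrCA [in LHS]big_mkcond big_ord_recl /= -big_mkcond.
Qed.

Section WordGeneratingFunctions.
Variables (T : finType) (R : comNzRingType).
Implicit Types (f g : seq T -> R) (P : pred (seq T)).

Definition indicator P (w : seq T) : R := (P w)%:R.

Definition convolution f g (w : seq T) : R :=
  \sum_(i < (size w).+1) f (take i w) * g (drop i w).

Definition word_gf f : fps R := Fps (fun n => \sum_(w : n.-tuple T) f w).

Lemma eq_word_gf f g : f =1 g -> word_gf f = word_gf g.
Proof. by move=> eq_fg; apply/fpsP => n; apply: eq_bigr => w _. Qed.

Lemma word_gfD f g : word_gf (f \+ g) = word_gf f + word_gf g.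
Proof. by apply/fpsP => n /=; rewrite -big_split. Qed.

Lemma sum_tuple_take_drop m n f g :
  \sum_(w : (m + n).-tuple T) f (take m w) * g (drop m w) =
  (\sum_(u : m.-tuple T) f u) * (\sum_(v : n.-tuple T) g v).
Proof.
rewrite (big_tuple_cat _ _ _ (fun w => f (take m w) * g (drop m w))) /=.
rewrite big_distrl /=; apply: eq_bigr => u _.
rewrite big_distrr /=; apply: eq_bigr => v _.
by rewrite take_size_cat ?drop_size_cat ?size_tuple.
Qed.

Lemma word_gfM f g : word_gf (convolution f g) = word_gf f * word_gf g.
Proof.
apply/fpsP => n; rewrite /= /convolution.
under eq_bigr do rewrite size_tuple.
rewrite exchange_big /=; apply: eq_bigr => i _.
by rewrite -sum_tuple_take_drop subnKC // -ltnS.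
Qed.

Lemma word_gf_nil : word_gf (indicator (fun w => size w == 0%N)) = 1.
Proof.
apply/fpsP => n /=; rewrite /indicator.
under eq_bigr do rewrite size_tuple.
by rewrite sumr_const card_tuple; case: n => // n; rewrite mul0rn.
Qed.

Lemma word_gf_letter :
  word_gf (indicator (fun w => size w == 1%N)) = #|T|%:R * fpsX R.
Proof.
apply/fpsP => n; rewrite mulr_natl fps_coefMn /= /indicator.
under eq_bigr do rewrite size_tuple.
by rewrite sumr_const card_tuple; case: n => [|[|n]]; rewrite ?expn1 // !mul0rn.
Qed.

Lemma convolution_letter_rcons f u a :
  convolution f (indicator (fun w => size w == 1%N)) (rcons u a) = f u.
Proof.
rewrite /convolution /indicator size_rcons !big_ord_recr /=.
rewrite big1 => [|i _].
  rewrite size_drop size_rcons subSnn mulr1 drop_oversize ?size_rcons //.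
  by rewrite mulr0 addr0 add0r -cats1 take_size_cat.
rewrite size_drop size_rcons (subSn (ltnW (ltn_ord i))) eqSS subn_eq0.
by rewrite leqNgt ltn_ord mulr0.
Qed.

End WordGeneratingFunctions.

Definition prefix_monotone (T : Type) (P : pred (seq T)) : Prop :=
  forall u v, P u -> P (u ++ v).

Definition suffix_monotone (T : Type) (P : pred (seq T)) : Prop :=
  forall u v, P v -> P (u ++ v).

Definition quasi_avoids (T : Type) (P : pred (seq T)) (w : seq T) : bool :=
  P w && [forall i : 'I_(size w), ~~ P (take i w)].

Section QuasiAvoidance.
Variables (T : Type) (P : pred (seq T)).

Lemma quasi_avoids_nil : quasi_avoids P [::] = P [::].
Proof.
by apply/andP/idP => [[]|Pnil]; last by split=> //; apply/forallP => -[].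
Qed.

Lemma quasi_avoids_takeP w m : (m <= size w)%N ->
  reflect (P (take m w) /\ forall i, (i < m)%N -> ~~ P (take i w))
          (quasi_avoids P (take m w)).
Proof.
move=> le_mw; apply: (iffP andP) => -[Pm notP]; split=> //.
  move=> i lt_im; have lt_i : (i < size (take m w))%N by rewrite size_takel.
  by have /forallP/(_ (Ordinal lt_i)) := notP; rewrite /= take_takel // ltnW.
apply/forallP => -[i /=]; rewrite size_takel // => lt_im.
by rewrite take_takel ?notP // ltnW.
Qed.

Lemma ex_quasi_avoids_take w : P w ->
  exists2 m, (m <= size w)%N & quasi_avoids P (take m w).
Proof.
move=> Pw; have exP : exists i, P (take i w).
  by exists (size w); rewrite take_size.
case: (ex_minnP exP) => m Pm min_m.
have le_mw : (m <= size w)%N by rewrite min_m ?take_size.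
exists m => //; apply/quasi_avoids_takeP => //; split=> // i.
by rewrite ltnNge; apply/contra/min_m.
Qed.

Lemma quasi_avoids_take_eq w m i : (m <= size w)%N -> (i <= size w)%N ->
  quasi_avoids P (take m w) -> quasi_avoids P (take i w) = (i == m).
Proof.
move=> le_mw le_iw qm; apply/idP/eqP => [|-> //].
move=> /(quasi_avoids_takeP le_iw)[Pi notPi].
have /(quasi_avoids_takeP le_mw)[Pm notPm] := qm.
by case: (ltngtP i m) => // [/notPm|/notPi]; rewrite ?Pi ?Pm.
Qed.

Hypothesis monoP : prefix_monotone P.

Lemma prefix_monotone_take i w : P (take i w) -> P w.
Proof. by move=> Pi; rewrite -(cat_take_drop i w); apply: monoP. Qed.

Lemma quasi_avoids_rcons u a :
  quasi_avoids P (rcons u a) = P (rcons u a) && ~~ P u.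
Proof.
rewrite -[X in quasi_avoids P X]take_size.
apply/quasi_avoids_takeP/andP => //; rewrite take_size size_rcons.
  case=> Pua notP; split=> //.
  by rewrite -(take_size_cat [:: a] (erefl (size u))) cats1 notP.
case=> Pua notPu; split=> // i lt_i.
rewrite -cats1 takel_cat //.
by apply: contra notPu; apply: prefix_monotone_take.
Qed.

End QuasiAvoidance.

Section AvoidanceGeneratingFunctions.
Variables (T : finType) (R : comNzRingType) (P : pred (seq T)).
Hypothesis monoP : prefix_monotone P.

Local Notation language_gf Q := (word_gf (indicator R Q)).

Lemma quasi_avoids_gf :
  language_gf (quasi_avoids P) =
  (#|T|%:R * fpsX R - 1) * language_gf (predC P) + 1.
Proof.
suff append_letter : language_gf (predC P) * (#|T|%:R * fpsX R) + 1 =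
    language_gf (predC P) + language_gf (quasi_avoids P).
  by apply: (addrI (language_gf (predC P))); rewrite -append_letter; ring.
rewrite -word_gf_letter -word_gfM -(word_gf_nil T R) -!word_gfD.
apply: eq_word_gf => w /=; case/lastP: w => [|u a].
  rewrite /convolution big_ord1 /indicator quasi_avoids_nil /= mulr0 add0r.
  by case: (P _); rewrite ?addr0 ?add0r.
rewrite convolution_letter_rcons /indicator quasi_avoids_rcons // size_rcons /=.
rewrite addr0 -natrD -cats1.
by have := @monoP u [:: a]; case: (P u) => [-> //|_]; case: (P _).
Qed.

Lemma convolution_quasi_avoids (f : seq T -> R) w m : (m <= size w)%N ->
  quasi_avoids P (take m w) ->
  convolution (indicator R (quasi_avoids P)) f w = f (drop m w).
Proof.
move=> le_mw qm; have lt_m : (m < (size w).+1)%N by [].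
rewrite /convolution /indicator (bigD1 (Ordinal lt_m)) //= qm mul1r.
rewrite big1 ?addr0 // => i; rewrite -val_eqE /= => /negPf ne_im.
by rewrite (quasi_avoids_take_eq le_mw) -1?ltnS // ne_im mul0r.
Qed.

Lemma convolution_quasi_avoids_eq0 (f : seq T -> R) w : ~~ P w ->
  convolution (indicator R (quasi_avoids P)) f w = 0.
Proof.
move=> notPw; rewrite /convolution big1 // => i _.
rewrite /indicator /quasi_avoids.
by rewrite (negPf (contra (@prefix_monotone_take _ _ monoP i w) notPw)) mul0r.
Qed.

Variables Q C : pred (seq T).
Hypothesis monoQ : suffix_monotone Q.
Hypothesis concatC :
  forall w, reflect (exists u v, [/\ w = u ++ v, P u & Q v]) (C w).

Lemma concat_drop_quasi_avoids w m : (m <= size w)%N ->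
  quasi_avoids P (take m w) -> C w = Q (drop m w).
Proof.
move=> le_mw /(quasi_avoids_takeP _ le_mw)[Pm notP].
apply/concatC/idP => [[u [v [def_w Pu Qv]]]|Qm]; last first.
  by exists (take m w), (drop m w); rewrite cat_take_drop.
have le_mu : (m <= size u)%N.
  rewrite leqNgt; apply/negP => /notP.
  by rewrite def_w take_size_cat ?Pu.
rewrite def_w drop_cat ltn_neqAle le_mu andbT.
by case: eqP => [->|_]; rewrite ?subnn ?drop0 //; apply: monoQ.
Qed.

Lemma avoid_concat_gf :
  language_gf (predC C) =
  language_gf (predC P) +
    ((#|T|%:R * fpsX R - 1) * language_gf (predC P) + 1) *
    language_gf (predC Q).
Proof.
rewrite -quasi_avoids_gf -word_gfM -word_gfD; apply: eq_word_gf => w /=.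
rewrite {1 2}/indicator /=; have [Pw|notPw] := boolP (P w).
  have [m le_mw qm] := ex_quasi_avoids_take Pw.
  rewrite (convolution_quasi_avoids _ le_mw qm) add0r.
  by rewrite (concat_drop_quasi_avoids le_mw qm).
rewrite convolution_quasi_avoids_eq0 // addr0.
case: concatC => // -[u [v [def_w Pu _]]].
by rewrite def_w monoP in notPw.
Qed.

End AvoidanceGeneratingFunctions.

Section Occurrences.
Implicit Types t u v w : seq nat.

Lemma occurs_at_size t w p :
  (p <= size w)%N -> occurs_at t w p -> (p + size t <= size w)%N.
Proof.
by move=> le_p /andP[/eqP + _]; rewrite size_take_min size_drop; lia.
Qed.

Lemma occurs_at_catl t u v p : (p + size t <= size u)%N ->
  occurs_at t (u ++ v) p = occurs_at t u p.
Proof.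
by move=> le_pu; rewrite /occurs_at !take_drop takel_cat // addnC.
Qed.

Lemma occurs_at_catr t u v p :
  occurs_at t (u ++ v) (size u + p) = occurs_at t v p.
Proof. by rewrite /occurs_at addnC -drop_drop drop_size_cat. Qed.

Lemma containsP t w :
  reflect (exists2 p, (p + size t <= size w)%N & occurs_at t w p)
          (contains t w).
Proof.
apply: (iffP existsP) => [[p tp]|[p le_p tp]].
  by exists p => //; apply: occurs_at_size tp; rewrite -ltnS.
by exists (inord p); rewrite inordK // ltnS (leq_trans (leq_addr _ _) le_p).
Qed.

Lemma mcontainsP s (tau : 'I_s -> seq nat) w :
  reflect (exists p : 'I_s -> nat,
             [/\ forall i, (p i + size (tau i) <= size w)%N,
                 forall i, occurs_at (tau i) w (p i) &
                 forall i j : 'I_s, (i < j)%N ->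
                   (p i + size (tau i) <= p j)%N])
          (mcontains tau w).
Proof.
apply: (iffP existsP) => [[p /andP[/forallP tp /forallP lt_p]]|].
  exists (fun i => p i : nat); split=> // [i|i j ij].
    by apply: occurs_at_size (tp i); rewrite -ltnS.
  by have /forallP/(_ j)/implyP := lt_p i; apply.
move=> [p [le_p tp lt_p]].
have p_ord i : (p i < (size w).+1)%N.
  by rewrite ltnS (leq_trans (leq_addr _ _) (le_p i)).
exists [ffun i => inord (p i)]; apply/andP; split; apply/forallP => i.
  by rewrite ffunE inordK.
apply/forallP => j; apply/implyP => ij.
by rewrite !ffunE !inordK // lt_p.
Qed.

Lemma contains_prefix_monotone t : prefix_monotone (contains t).
Proof.
move=> u v /containsP[p le_p tp]; apply/containsP; exists p.
  by rewrite size_cat (leq_trans le_p) ?leq_addr.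
by rewrite occurs_at_catl.
Qed.

Lemma mcontains_suffix_monotone s (tau : 'I_s -> seq nat) :
  suffix_monotone (mcontains tau).
Proof.
move=> u v /mcontainsP[p [le_p tp lt_p]]; apply/mcontainsP.
exists (fun i => size u + p i)%N; split=> [i|i|i j ij].
- by rewrite size_cat -addnA leq_add2l.
- by rewrite occurs_at_catr.
- by rewrite -addnA leq_add2l lt_p.
Qed.

Lemma mcontains0 (tau : 'I_0 -> seq nat) w : mcontains tau w.
Proof. by apply/mcontainsP; exists (fun=> 0%N); split=> [] []. Qed.

Lemma mcontains_cat s (tau : 'I_s.+1 -> seq nat) u v :
  contains (tau ord0) u -> mcontains (fun j => tau (lift ord0 j)) v ->
  mcontains tau (u ++ v).
Proof.
move=> /containsP[p0 le_p0 tp0] /mcontainsP[p [le_p tp lt_p]].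
pose pos (j : 'I_s.+1) :=
  if unlift ord0 j is Some l then (size u + p l)%N else p0.
have pos0 : pos ord0 = p0 by rewrite /pos unlift_none.
have posS l : pos (lift ord0 l) = (size u + p l)%N by rewrite /pos liftK.
apply/mcontainsP; exists pos; split=> [j|j|j l].
- rewrite size_cat; case: (unliftP ord0 j) => [l ->|->]; rewrite ?pos0 ?posS.
    by rewrite -addnA leq_add2l.
  by rewrite (leq_trans le_p0) ?leq_addr.
- case: (unliftP ord0 j) => [l ->|->]; rewrite ?pos0 ?posS.
    by rewrite occurs_at_catr.
  by rewrite occurs_at_catl.
- case: (unliftP ord0 l) => [l' ->|-> //]; rewrite posS.
  case: (unliftP ord0 j) => [j' ->|-> _]; rewrite ?pos0 ?posS.
    by rewrite !lift0 ltnS -addnA leq_add2l => /lt_p.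
  by rewrite (leq_trans le_p0) ?leq_addr.
Qed.

Lemma mcontains_catP s (tau : 'I_s.+1 -> seq nat) w :
  reflect (exists u v, [/\ w = u ++ v, contains (tau ord0) u &
                           mcontains (fun j => tau (lift ord0 j)) v])
          (mcontains tau w).
Proof.
apply: (iffP idP) => [/mcontainsP[p [le_p tp lt_p]]|]; last first.
  by move=> [u [v [-> ? ?]]]; apply: mcontains_cat.
set stop := (p ord0 + size (tau ord0))%N in le_p lt_p *.
have le_stop j : (stop <= p (lift ord0 j))%N by apply: lt_p.
have size_u : size (take stop w) = stop by apply/size_takel/le_p.
exists (take stop w), (drop stop w); rewrite cat_take_drop; split=> //.
  apply/containsP; exists (p ord0); first by rewrite size_u.
  by rewrite -(occurs_at_catl (drop stop w)) ?size_u // cat_take_drop.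
apply/mcontainsP; exists (fun j => p (lift ord0 j) - stop)%N.
split=> [j|j|j l jl].
- by rewrite size_drop; have := le_p (lift ord0 j); have := le_stop j; lia.
- by rewrite -(occurs_at_catr _ (take stop w)) cat_take_drop size_u subnKC.
- by have := lt_p (lift ord0 j) (lift ord0 l) jl; have := le_stop j; lia.
Qed.

End Occurrences.

Definition letters (k : nat) (w : seq 'I_k) : seq nat :=
  [seq (nat_of_ord i).+1 | i <- w].

Lemma avoid_gfE (P : pred (seq nat)) (k : nat) :
  avoid_gf P k = word_gf (indicator int (predC (P \o @letters k))).
Proof.
apply/fpsP => n /=; rewrite /avoid_count -sum1_card natr_sum big_mkcond /=.
by apply: eq_bigr => w _; rewrite /indicator inE /=; case: (P _).
Qed.

Lemma A_mpat0 (tau : 'I_0 -> seq nat) (k : nat) : A_mpat tau k = 0.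
Proof.
rewrite /A_mpat avoid_gfE; apply/fpsP => n /=; rewrite big1 // => w _.
by rewrite /indicator /= mcontains0.
Qed.

Lemma A_mpat_recl s (tau : 'I_s.+1 -> seq nat) k :
  A_mpat tau k = A_pat (tau ord0) k +
    ((k%:R * fpsX int - 1) * A_pat (tau ord0) k + 1) *
    A_mpat (fun j => tau (lift ord0 j)) k.
Proof.
rewrite /A_mpat /A_pat !avoid_gfE -[in k%:R](card_ord k).
apply: avoid_concat_gf => [u v|u v|w]; rewrite /= /letters ?map_cat.
- exact: contains_prefix_monotone.
- exact: mcontains_suffix_monotone.
apply: (iffP (mcontains_catP _ _)) => [[u [v [def_w u_tau v_tau]]]|].
  exists (take (size u) w), (drop (size u) w).
  by rewrite cat_take_drop map_take map_drop def_w take_size_cat ?drop_size_cat.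
by move=> [u [v [-> ? ?]]]; exists (letters u), (letters v); rewrite -map_cat.
Qed.

Theorem mainTheorem12 (s : nat) (tau : 'I_s -> seq nat) (k : nat)
    (hs : (0 < s)%N)
    (htau : forall i : 'I_s, gen_pattern (tau i) /\ tau i <> [::])
    (hk : (1 <= k)%N) :
  A_mpat tau k =
    \sum_(j < s) A_pat (tau j) k *
      \prod_(i < s | (i < j)%N) ((k%:R * fpsX int - 1) * A_pat (tau i) k + 1).
Proof.
elim: s tau {hs htau hk} => [|s IHs] tau; first by rewrite A_mpat0 big_ord0.
by rewrite A_mpat_recl IHs [RHS]sum_prod_lt_recl.
Qed.
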